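(* Let $p$ be a prime, let $n$ be a positive integer and let $q = p^n$. Let $V$ be the natural $2$-dimensional module over the field $\mathrm{GF}(q)$ for the group $S = \mathrm{SL}_2(q)$, and let $G = V \rtimes S$ be the corresponding semidirect product. Then $(G,V)$ is an equal order pair if and only if $p$ is odd.
   Context: If $G$ is a finite group and $N$ is a proper, nontrivial, normal subgroup of $G$, the pair $(G,N)$ is called an equal order pair if, for every $x \in G \setminus N$, all elements of the coset $xN$ have the same order as $x$. *)

(* Defs.v *)
From HB Require Import structures.
From mathcomp Require Import all_boot all_order all_fingroup all_algebra.
From mathcomp Require Import all_solvable all_field all_character.

Set Implicit Arguments.
Unset Strict Implicit.
Unset Printing Implicit Defensive.

Import GRing.Theory FinRing.Theory.
Local Open Scope ring_scope.
Local Open Scope group_scope.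

Definition equal_order_pair (gT : finGroupType) (G N : {group gT}) : Prop :=
  [/\ N \proper G, N :!=: 1, N <| G
    & forall x, x \in G :\: N -> forall y, y \in x *: N -> #[y] = #[x]].

Section AffineSpecialLinear.

Variable F : finFieldType.

Definition SL2 : {set {'GL_2[F]}} := [set g : {'GL_2[F]} | \det (GLval g) == 1%R].

Lemma SL2_group_set : group_set SL2.
Proof.
apply/group_setP; split=> [|g h]; first by rewrite inE GL_1E det1.
by rewrite !inE GL_ME det_mulmx => /eqP-> /eqP->; rewrite mulr1.
Qed.

Canonical SL2_group : {group {'GL_2[F]}} := Group SL2_group_set.

Lemma SL2_sub_GL2 : SL2_group \subset 'GL_2[F].
Proof. exact: subsetT. Qed.

(* GLrepr F n is the natural representation of 'GL_n.+1[F]. *)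
Definition SL2_repr : mx_representation F SL2_group 2 :=
  subg_repr (GLrepr F 1) SL2_sub_GL2.

(* SL2 acts on the right of the row vectors of F^2, by v |-> v *m g. *)
Definition SL2_act : groupAction SL2_group [set: 'rV[F]_2] :=
  ('MR SL2_repr)%gact.

Definition ASL2_type : finGroupType := sdprod_groupType SL2_act.

Definition ASL2 : {group ASL2_type} := [set: ASL2_type]%G.

Definition ASL2_V : {group ASL2_type} :=
  (sdpair1 SL2_act @* [set: 'rV[F]_2])%G.

End AffineSpecialLinear.

(* Main.v *)
Require Import Defs.
From mathcomp Require Import all_boot all_order all_fingroup all_algebra.
From mathcomp Require Import all_solvable all_field all_character ring.

(** Write an element of [G] as [s v], with [s] in [SL_2(q)] and [v] in [V]; then
    [(s v)^m = s^m (v *m (1 + s + ... + s^(m-1)))]. If [s^m = 1], [s <> 1] and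
    [p] is odd, the geometric sum vanishes, so that [s v] has the order of [s]
    whatever [v] is: either [s - 1] is invertible, and it kills the sum, or
    [u = s - 1] is nilpotent because [det s = 1], and the sum is
    [m + 'C(m, 2) u] with [p] dividing both [m] and ['C(m, 2)]. If [p = 2], the
    transvection [s = 1 + u] has order 2, but its sum [1 + s = u] is nonzero. *)

Set Implicit Arguments.
Unset Strict Implicit.
Unset Printing Implicit Defensive.

Import GRing.Theory FinRing.Theory.

Lemma dvdn_bin2 p m : odd p -> p %| m -> p %| 'C(m, 2).
Proof.
move=> p_odd p_m; rewrite -(@Gauss_dvdr _ 2) ?coprimen2 //.
by rewrite -mul_bin_diag dvdn_mulr.
Qed.

Section GeometricSum.

Local Open Scope ring_scope.

Lemma det_mx22 (R : comNzRingType) (M : 'M[R]_2) :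
  \det M = M 0 0 * M 1 1 - M 0 1 * M 1 0.
Proof.
rewrite (expand_det_row _ 0) !big_ord_recl big_ord0 /cofactor !det_mx11 !mxE /=.
rewrite expr0 expr1 mul1r mulN1r mulrN addr0.
by congr (M _ _ * M _ _ - M _ _ * M _ _); apply: val_inj.
Qed.

(** Since [det (1 + u) = 1 + tr u + det u], the hypotheses force [tr u = 0], and Cayley-Hamilton
    reduces to [u ^+ 2 = 0]. *)
Lemma mx22_nilpotent (R : comNzRingType) (u : 'M[R]_2) :
  \det u = 0 -> \det (1 + u) = 1 -> u ^+ 2 = 0.
Proof.
rewrite !det_mx22 !mxE /= !add0r => det_u det_s.
have tr_u: u 1 1 = - u 0 0.
  apply/eqP; rewrite -addr_eq0; apply/eqP.
  have -> : u 1 1 + u 0 0 = ((1 + u 0 0) * (1 + u 1 1) - u 0 1 * u 1 0)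
      - 1 - (u 0 0 * u 1 1 - u 0 1 * u 1 0) by ring.
  by rewrite det_s det_u subr0 subrr.
have ord2E (i : 'I_2) : i = 0 \/ i = 1.
  by case: i => [[|[|i]] ?] //; [left | right]; apply: val_inj.
apply/matrixP=> i j; rewrite expr2 mxE 2!big_ord_recl big_ord0 addr0 mxE.
have -> : lift ord0 ord0 = 1 :> 'I_2 by apply: val_inj.
rewrite -[ord0]/(0 : 'I_2).
(* Off the diagonal, an entry of [u ^+ 2] is a multiple of the trace; on the diagonal it equals
   [- \det u]. *)
case: (ord2E i) (ord2E j) => -> [] ->; rewrite ?tr_u; try ring.
  by rewrite -[RHS]oppr0 -det_u tr_u; ring.
by rewrite -[RHS]oppr0 -det_u tr_u; ring.
Qed.

(** The binomial expansion stops at [1 + u *+ i], and the exponents [i < m] add up to ['C(m, 2)]. *)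
Lemma sum_expr_unipotent (R : nzRingType) (u : R) m :
  u ^+ 2 = 0 -> \sum_(i < m) (1 + u) ^+ i = m%:R + u *+ 'C(m, 2).
Proof.
move=> u2; have powE i: (1 + u) ^+ i = 1 + u *+ i.
  elim: i => [|i IHi]; first by rewrite expr0 addr0.
  rewrite exprS IHi mulrDl mul1r mulrDr mulr1 mulrnAr -expr2 u2 mul0rn addr0.
  by rewrite mulrS -addrA [u *+ i + u]addrC.
elim: m => [|m IHm]; first by rewrite big_ord0 bin0n addr0.
rewrite big_ord_recr /= IHm powE binS bin1 mulrnDr -natr1.
by rewrite addrACA.
Qed.

Lemma sum_expr_eq0 (F : finFieldType) p (s : 'M[F]_2) m :
    odd p -> p \in [pchar F] -> \det s = 1 -> s != 1 -> s ^+ m = 1 ->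
  \sum_(i < m) s ^+ i = 0.
Proof.
move=> p_odd pF det_s s_neq1 sm1.
have: (s - 1) * \sum_(i < m) s ^+ i = 0 by rewrite -subrX1 sm1 subrr.
have [Us | nUs] := boolP (s - 1 \is a GRing.unit).
  by move/(congr1 ( *%R (s - 1)^-1)); rewrite mulKr // mulr0.
move=> _; set u := s - 1 in nUs; have Ds: s = 1 + u by rewrite addrC subrK.
have u_neq0: u != 0 by rewrite subr_eq0.
have u2: u ^+ 2 = 0.
  apply: mx22_nilpotent; last by rewrite -Ds.
  apply/eqP; move: nUs.
  by rewrite -[u \is a _]/(u \in unitmx) unitmxE unitfE negbK.
(* In [s ^+ m - 1 = u * (m + 'C(m, 2) u)] the left side is 0 and the quadratic term dies. As [u] is
   a nonzero vector over [F], the characteristic then divides [m]. *)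
have um0: u *+ m = 0.
  have := subrX1 s m; rewrite sm1 subrr Ds sum_expr_unipotent //.
  rewrite -Ds -/u mulrDr mulr_natr mulrnAr -expr2 u2 mul0rn addr0.
  by move/esym.
have p_m: (p %| m)%N.
  rewrite (dvdn_pcharf pF); move/eqP: um0.
  by rewrite -scaler_nat scaler_eq0 (negPf u_neq0) orbF.
rewrite Ds sum_expr_unipotent // -[m%:R]scaler_nat -[u *+ _]scaler_nat.
have /eqP-> : m%:R == 0 :> F by rewrite -(dvdn_pcharf pF).
have /eqP-> : 'C(m, 2)%:R == 0 :> F by rewrite -(dvdn_pcharf pF) dvdn_bin2.
by rewrite !scale0r addr0.
Qed.

End GeometricSum.

Section AffineGroup.

Variable F : finFieldType.
Local Notation S := (SL2_group F).
Local Notation V := [set: 'rV[F]_2].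
Local Notation A := (sdpair1 (SL2_act F)).
Local Notation B := (sdpair2 (SL2_act F)).
Implicit Types (s : {'GL_2[F]}) (v : 'rV[F]_2).

Local Open Scope group_scope.

Lemma GL_XE s i : GLval (s ^+ i) = (GLval s ^+ i)%R.
Proof. by elim: i => // i IHi; rewrite expgS GL_ME IHi exprS. Qed.

Lemma sdpair1_conjg s v : s \in S -> A v ^ B s = A (v *m GLval s)%R.
Proof.
move=> Ss; transitivity (A (SL2_act F v s)).
  by rewrite sdpair_act ?in_setT.
by congr A; apply: mx_repr_actE.
Qed.

Lemma ASL2_expg s v m : s \in S ->
  (B s * A v) ^+ m = B (s ^+ m) * A (v *m (\sum_(i < m) GLval s ^+ i))%R.
Proof.
move=> Ss; elim: m => [|m IHm].
  by rewrite big_ord0 mulmx0 !expg0 (morph1 B) (morph1 A) mulg1.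
rewrite expgSr IHm -mulgA [A _ * _]mulgA [A _ * B s]conjgC.
rewrite sdpair1_conjg //.
rewrite expgSr (morphM B) ?groupX // -!mulgA -(morphM A) ?in_setT //.
congr (_ * (_ * A _)).
(* The new factor [v] supplies the term of exponent 0; multiplying the old sum by [s] shifts its
   exponents up by one. *)
rewrite big_ord_recl expr0 mulmxDr mulmx1 addrC -mulmxA mulmx_suml.
by congr (_ *m _ + v)%R; apply: eq_bigr => i _; rewrite exprSr.
Qed.

(** The factor [A v] lies in the normal subgroup, which meets the complement trivially. *)
Lemma sdpair2_mem_V s v : s \in S -> (B s * A v \in ASL2_V F) = (s == 1).
Proof.
move=> Ss; rewrite groupMr ?mem_morphim ?inE //.
apply/idP/eqP=> [Vs | ->]; last by rewrite (morph1 B) group1.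
have: B s \in A @* V :&: B @* S by rewrite inE Vs mem_morphim.
rewrite im_sdpair_TI => /set1P Bs1.
by apply/eqP; rewrite -(morph_injm_eq1 (injm_sdpair2 (SL2_act F))) //; apply/eqP.
Qed.

Lemma ASL2_order p s v : odd p -> p \in [pchar F]%R -> s \in S -> s != 1 ->
  #[B s * A v] = #[s].
Proof.
move=> p_odd pF Ss s_neq1; apply/eqP; rewrite eqn_dvd; apply/andP; split.
  rewrite order_dvdn ASL2_expg // expg_order (morph1 B) mul1g.
  rewrite (sum_expr_eq0 p_odd pF) ?mulmx0 ?(morph1 A) //.
  - by move: Ss; rewrite inE => /eqP.
  - by rewrite -GL_XE expg_order.
(* Conversely, the [m]-th power is 1, hence lies in the image of [V], so its component [s ^+ m] is
   trivial. *)
set m := #[B s * A v].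
rewrite order_dvdn -(@sdpair2_mem_V _ (v *m \sum_(i < m) GLval s ^+ i)%R) ?groupX //.
by rewrite -ASL2_expg // expg_order group1.
Qed.

Lemma transvection_unit : (1 + delta_mx 0 1 : 'M[F]_2)%R \is a GRing.unit.
Proof.
by rewrite -[_ \is a _]/(_ \in unitmx) unitmxE det_mx22 !mxE /=
  !addr0 !mulr1 !mulr0 subr0 unitr1.
Qed.

(** A nontrivial element of [S] over every [F]: it shows that the image of [V] is proper, and it
    gives the counterexample in characteristic 2. *)
Definition transvection : {'GL_2[F]} := FinRing.unit _ transvection_unit.

Lemma transvection_SL2 : transvection \in S.
Proof. by rewrite inE det_mx22 !mxE /= !addr0 !mulr1 !mulr0 subr0. Qed.

Lemma transvection_neq1 : transvection != 1.
Proof.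
apply/eqP=> /(congr1 (fun s : {'GL_2[F]} => GLval s 0%R 1%R)) /eqP.
by rewrite !mxE /= add0r oner_eq0.
Qed.

Lemma ASL2_V_proper : ASL2_V F \proper ASL2 F.
Proof.
rewrite properE subsetT /=; apply/subsetPn.
exists (B transvection * A 0%R); rewrite ?inE //.
by rewrite sdpair2_mem_V ?transvection_SL2 ?transvection_neq1.
Qed.

Lemma ASL2_V_neq1 : ASL2_V F :!=: 1.
Proof.
rewrite /= morphim_injm_eq1 ?injm_sdpair1 //.
apply/trivgPn; exists (delta_mx 0 0)%R; rewrite ?inE //.
apply/eqP=> /matrixP/(_ 0 0)%R /eqP.
by rewrite !mxE /= oner_eq0.
Qed.

Lemma ASL2_V_normal : ASL2_V F <| ASL2 F.
Proof. by have /sdprod_context[] := sdprod_sdpair (SL2_act F). Qed.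

Lemma ASL2_equal_order p : odd p -> p \in [pchar F]%R ->
  equal_order_pair (ASL2 F) (ASL2_V F).
Proof.
move=> p_odd pF; split=> [|||x /setDP[_ V'x] y /lcosetP[_ /morphimP[w _ _ ->] ->]].
- exact: ASL2_V_proper.
- exact: ASL2_V_neq1.
- exact: ASL2_V_normal.
have [s Ss [v Dx]] : exists2 s, s \in S & exists v, x = B s * A v.
  exists x.1; first by case: (x) => -[? ?] /= /setXP[].
  by exists x.2; apply: sdpairE.
have s_neq1 : s != 1 by rewrite -(sdpair2_mem_V v) // -Dx.
(* Moving within the coset replaces [v] by [v + w] and keeps [s], which alone determines the
   order. *)
by rewrite Dx -mulgA -(morphM A) ?inE // !(ASL2_order _ p_odd pF).
Qed.

Lemma ASL2_not_equal_order : 2 \in [pchar F]%R ->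
  ~ equal_order_pair (ASL2 F) (ASL2_V F).
Proof.
move=> F2 [_ _ _ eq_order]; set s := transvection.
have Ss : s \in S := transvection_SL2.
(* This basis vector is not killed by [delta_mx 0 1], the geometric sum computed next. *)
pose v : 'rV[F]_2 := delta_mx 0%R 0%R.
have sum2 : (\sum_(i < 2) GLval s ^+ i)%R = delta_mx 0%R 1%R.
  rewrite 2!big_ord_recr big_ord0 /= add0r expr0 expr1 addrA.
  by rewrite -[(1 + 1)%R]/(2%:R)%R -scaler_nat (pcharf0 F2) scale0r add0r.
have y2 w : (B s * A w) ^+ 2 = A (w *m delta_mx 0 1)%R.
  rewrite ASL2_expg // sum2.
  have -> : s ^+ 2 = 1; last by rewrite (morph1 B) mul1g.
  apply: val_inj; apply: etrans (GL_XE s 2) _; apply/eqP.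
  (* Here [s ^+ 2 - 1 = (s - 1)(1 + s)] is the square of [delta_mx 0 1], which vanishes. *)
  by rewrite -[X in _ == X]/1%R -subr_eq0 subrX1 sum2 /= addrC addKr -mulmxE mul_delta_mx_0.
have /eq_order/(_ (B s * A v)) : B s * A 0%R \in ASL2 F :\: ASL2_V F.
  by rewrite inE sdpair2_mem_V // transvection_neq1 inE.
rewrite (morph1 A) mulg1 mem_lcoset mulKg mem_morphim ?inE // => /(_ isT) ord_y.
(* Equal orders would transfer the relation [(B s) ^+ 2 = 1] to [B s * A v], whose square is a
   nontrivial translation. *)
have: (B s * A v) ^+ 2 == 1.
  have := y2 0%R; rewrite mul0mx (morph1 A) mulg1 => x2.
  by rewrite -order_dvdn ord_y order_dvdn x2.
rewrite y2 mul_delta_mx => /eqP; rewrite -(morph1 A).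
move/(injmP (injm_sdpair1 (SL2_act F)) _ _ (in_setT _) (in_setT _)).
by move/matrixP/(_ 0 1)%R /eqP; rewrite !mxE /= oner_eq0.
Qed.

End AffineGroup.

Theorem mainTheorem5 (p n : nat) (F : finFieldType) :
  prime p -> 0 < n -> #|F| = p ^ n ->
  (equal_order_pair (ASL2 F) (ASL2_V F) <-> odd p).
Proof.
move=> p_pr _ cardF; have pF := card_finPcharP cardF p_pr; split=> [eqF | p_odd].
  case: (even_prime p_pr) => // p2; rewrite p2 in pF.
  by case: (ASL2_not_equal_order pF).
exact: ASL2_equal_order p_odd pF.
Qed.
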